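(* Let $\mathcal C$ be a small category satisfying the nine axioms (A1)–(A9). For every epimorphism $e:A\to D$ and strong monomorphism $m:D\to B$, the category $\mathcal F(e,m)$ has a terminal object $(C,c,u)$. The square $cu=me$ of this terminal object is also a pushout. In the representation of $\mathcal C$ by trees, the object $C$ is obtained from $B$ by replacing the subtree selected by $m$ with $A$.
   Context: AXIOMS. Let $\mathcal C$ be a small category. A monomorphism $m:A\to B$ is strong if for every epimorphism $e:P\to Q$ and all $a:P\to A$, $b:Q\to B$ with $ma=be$ there is $\ell:Q\to A$ with $\ell e=a$ and $m\ell=b$. The nine axioms are: (A1) There is a terminal object $1$ (fixed); $q_X:X\to 1$ is the unique morphism, and a point of $Y$ is a morphism $1\to Y$. (A2) Every morphism factors as $me$ with $e$ an epimorphism and $m$ a strong monomorphism. (A3) For every epimorphism $d:X\to Y$ and strong monomorphism $v:B\to Y$ the pullback of $d$ and $v$ exists and its projection to $B$ is an epimorphism. (A4) For every strong monomorphism $u:A\to X$ and epimorphism $a:A\to B$ there is a pushout square $cu=va$ ($c:X\to Y$, $v:B\to Y$) with $v$ a strong monomorphism, and this square is also a pullback. (A5) The class of epimorphisms whose pullbacks along all but at most one point of their codomain are isomorphisms is stable under pushout along strong monomorphisms. (A6) For every object $A$ and point $j:1\to B$ the category $\mathcal F(A,j)$ has a terminal object. Its objects are triples $(C,d,u)$ with $u:A\to C$ a strong monomorphism and $d:C\to B$ an epimorphism such that the square $du=jq_A$ is a pullback; its morphisms $(C',d',u')\to(C,d,u)$ are morphisms $h:C'\to C$ with $hu'=u$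 and $dh=d'$. (A7) For every object $X$ there are finitely many strong monomorphisms with codomain $X$ and finitely many epimorphisms with domain $X$ (counted as individual arrows, with all possible other endpoints). (A8) For every commutative square of strong monomorphisms $ca=db$ ($a:W\to X$, $b:W\to Y$, $c:X\to Z$, $d:Y\to Z$) there is $h:X\to Y$ with $ha=b$, $dh=c$, or there is $k:Y\to X$ with $kb=a$, $ck=d$. (A9) If the pullback of an epimorphism $d:X\to Y$ along every point of $Y$ is an isomorphism, then $d$ is an identity. Here ''the pullback of $d$ along a point $j:1\to Y$'' is the projection $X\times_Y1\to1$. THE CATEGORY $\mathcal F(e,m)$. For an epimorphism $e:A\to D$ and a strong monomorphism $m:D\to B$, objects of $\mathcal F(e,m)$ are triples $(C,c,u)$ with $u:A\to C$ a morphism and $c:C\to B$ an epimorphism such that the square $cu=me$ is a pullback (of $c$ and $m$, with projections $u$ to $C$ and $e$ to $D$). A morphism $(C',c',u')\to(C,c,u)$ is $h:C'\to C$ with $hu'=u$ and $ch=c'$. EXPRESSION TREE CATEGORIES. A ranked set is a set $L$ with a function $\operatorname{ar}:L\to\mathbb N$. Trees over $L$: the empty leaf $1$ is a tree, and for $\lambda\in L$, $n=\operatorname{ar}(\lambda)$ and trees $T_1,\dots,T_n$ there is a tree $\lambda(T_1,\dots,T_n)$; equality is syntactic. Positions: $\operatorname{Pos}(1)=\{()\}$, and $\operatorname{Pos}(\lambda(T_1,\dots,T_n))$ consists of the empty word and the words $pb$ with $1\le p\le n$, $b\in\operatorname{Pos}(T_p)$; $X|_a$ is the entire subtree at $a$.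 An occurrence $A\to X$ is a position $a$ with $X|_a=A$; occurrences compose by concatenating addresses. $T$ is obtainable from $X$ by pruning if $T=1$, or $X=\lambda(X_1,\dots,X_n)$ and $T=\lambda(T_1,\dots,T_n)$ with each $T_p$ obtainable from $X_p$; then there is exactly one pruning map $d:X\to T$ (otherwise none), $\operatorname{Pos}(T)\subseteq\operatorname{Pos}(X)$, and $p_d$ sends a position of $X$ to its longest prefix in $\operatorname{Pos}(T)$. $\mathcal C_L$ has trees as objects; a morphism $X\to Y$ is a pair $(d,u)$ of a pruning map $d:X\to T$ and an occurrence $u:T\to Y$. For $(d,u):X\to Y$ with $u$ at address $a$ and $(e,v):Y\to Z$ with $e:Y\to S$, the composite is $(e_ad,vu')$, where $u'$ is the occurrence of $S|_{p_e(a)}$ in $S$ at $p_e(a)$ and $e_a:Y|_a\to S|_{p_e(a)}$ is the pruning map. Identities are the pairs of identities. REPRESENTATION BY TREES. Under the axioms all isomorphisms are identities and every morphism factors uniquely as an epimorphism followed by a strong monomorphism. A strong monomorphism $i:A\to X$ is indecomposable if it is not an identity and whenever $i=vu$ with $u,v$ strong monomorphisms, $u$ or $v$ is an identity; $\operatorname{Comp}(X)$ is the set of these. Let $\mathcal E^\circ$ consist of epimorphisms with codomain $\ne1$ together with $\mathrm{id}_1$; an object is normal if its only outgoing morphism in $\mathcal E^\circ$ is its identity; each $X$ has a unique $\rho_X:X\to r(X)$ in $\mathcal E^\circ$ with normal target; $\Phi$ is the set of normal objects $\ne 1$, with $\operatorname{ar}(\phi)=|\operatorname{Comp}(\phi)|$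 and a chosen bijection $\operatorname{Comp}(\phi)\cong\{1,\dots,\operatorname{ar}(\phi)\}$. For $X\ne1$, sending $i\in\operatorname{Comp}(X)$ to the strong monomorphism part of $\rho_Xi$ is a bijection $\operatorname{Comp}(X)\to\operatorname{Comp}(r(X))$; let $X_p$ be the domain of the component corresponding to $p$. The representation of $\mathcal C$ by trees is the isomorphism $\mathcal C\cong\mathcal C_\Phi$ that sends $1$ to the empty leaf and $X\neq1$ to the tree with root label $r(X)$ and children the trees of the $X_p$; it carries epimorphisms to pruning maps and strong monomorphisms to occurrences (a composite of components corresponding to the path of input places it traverses). *)

(* Defs.v *)
From mathcomp Require Import all_boot.
From mathcomp Require Import boolp classical_sets functions cardinality.
Set Implicit Arguments.
Unset Strict Implicit.
Unset Printing Implicit Defensive.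

Declare Scope cat_scope.
Delimit Scope cat_scope with cat.
Local Open Scope cat_scope.

Reserved Notation "g ∘ f" (at level 40, left associativity).

Record category := Category {
  Ob :> Type;
  Hom : Ob -> Ob -> Type;
  idm : forall X : Ob, Hom X X;
  comp : forall X Y Z : Ob, Hom Y Z -> Hom X Y -> Hom X Z;
  comp_idl : forall (X Y : Ob) (f : Hom X Y), comp (idm Y) f = f;
  comp_idr : forall (X Y : Ob) (f : Hom X Y), comp f (idm X) = f;
  comp_assoc : forall (W X Y Z : Ob) (h : Hom Y Z) (g : Hom X Y) (f : Hom W X),
    comp h (comp g f) = comp (comp h g) f }.

Arguments Hom {c} X Y.
Arguments idm {c} X.
Arguments comp {c X Y Z} g f.
Notation "g ∘ f" := (comp g f) : cat_scope.

Section Arrows.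
Variable C : category.
Implicit Types A B P Q X Y Z : C.

Definition epi X Y (f : Hom X Y) : Prop :=
  forall Z (g h : Hom Y Z), g ∘ f = h ∘ f -> g = h.

Definition mono X Y (f : Hom X Y) : Prop :=
  forall Z (g h : Hom Z X), f ∘ g = f ∘ h -> g = h.

Definition strong_mono A B (m : Hom A B) : Prop :=
  mono m /\
  forall P Q (e : Hom P Q) (a : Hom P A) (b : Hom Q B),
    epi e -> m ∘ a = b ∘ e -> exists l : Hom Q A, l ∘ e = a /\ m ∘ l = b.

Definition is_iso X Y (f : Hom X Y) : Prop :=
  exists g : Hom Y X, g ∘ f = idm X /\ f ∘ g = idm Y.

(* Since [X] and [Y] need not be syntactically equal, "[f] is an identity" is
   an inductive family: it holds exactly when [X = Y] and [f] is [idm X]. *)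
Inductive is_identity : forall X Y, Hom X Y -> Prop :=
| IsIdentity X : is_identity (idm X).

(* [f p = g q] is a pullback of [f] and [g]. *)
Definition is_pullback X Y Z P (f : Hom X Z) (g : Hom Y Z)
    (p : Hom P X) (q : Hom P Y) : Prop :=
  f ∘ p = g ∘ q /\
  forall W (x : Hom W X) (y : Hom W Y), f ∘ x = g ∘ y ->
    exists! h : Hom W P, p ∘ h = x /\ q ∘ h = y.

(* [p f = q g] is a pushout of [f] and [g]. *)
Definition is_pushout X Y Z P (f : Hom Z X) (g : Hom Z Y)
    (p : Hom X P) (q : Hom Y P) : Prop :=
  p ∘ f = q ∘ g /\
  forall W (x : Hom X W) (y : Hom Y W), x ∘ f = y ∘ g ->
    exists! h : Hom P W, h ∘ p = x /\ h ∘ q = y.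

Definition is_terminal X : Prop := forall Y, exists f : Hom Y X, forall g, f = g.

End Arrows.

Record terminal_object (C : category) := TerminalObject {
  one :> C;
  to_one : forall X : C, Hom X one;
  to_one_unique : forall (X : C) (f : Hom X one), f = to_one X }.

Section FullSubcategory.
Variables (C : category) (P : C -> Prop).

Definition full : category :=
  @Category {X : C | P X} (fun X Y => Hom (sval X) (sval Y))
    (fun X => idm (sval X)) (fun X Y Z g f => g ∘ f)
    (fun X Y f => comp_idl f) (fun X Y f => comp_idr f)
    (fun W X Y Z h g f => comp_assoc h g f).

End FullSubcategory.

Section Triples.
Variables (C : category) (A B : C).

Record triple := Triple {
  tr_ob : C;
  tr_down : Hom tr_ob B;
  tr_in : Hom A tr_ob }.

Definition triple_hom (s t : triple) : Type :=
  {h : Hom (tr_ob s) (tr_ob t) |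
    h ∘ tr_in s = tr_in t /\ tr_down t ∘ h = tr_down s}.

Lemma triple_hom_eq s t (f g : triple_hom s t) : sval f = sval g -> f = g.
Proof.
by case: f g => [f Hf] [g Hg] /= E; move: Hg; rewrite -E => Hg; congr exist;
  exact: Prop_irrelevance.
Qed.

Definition triple_id (t : triple) : triple_hom t t :=
  exist _ (idm (tr_ob t)) (conj (comp_idl _) (comp_idr _)).

Lemma triple_comp_subproof s t r (g : triple_hom t r) (f : triple_hom s t) :
  (sval g ∘ sval f) ∘ tr_in s = tr_in r /\
  tr_down r ∘ (sval g ∘ sval f) = tr_down s.
Proof.
by case: f g => [f [f1 f2]] [g [g1 g2]] /=; rewrite -comp_assoc f1 g1
  comp_assoc g2 f2.
Qed.

Definition triple_comp s t r (g : triple_hom t r) (f : triple_hom s t) :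
  triple_hom s r := exist _ (sval g ∘ sval f) (triple_comp_subproof g f).

Lemma triple_idl s t (f : triple_hom s t) : triple_comp (triple_id t) f = f.
Proof. exact/triple_hom_eq/comp_idl. Qed.

Lemma triple_idr s t (f : triple_hom s t) : triple_comp f (triple_id s) = f.
Proof. exact/triple_hom_eq/comp_idr. Qed.

Lemma triple_assoc q r s t (h : triple_hom s t) (g : triple_hom r s)
    (f : triple_hom q r) :
  triple_comp h (triple_comp g f) = triple_comp (triple_comp h g) f.
Proof. exact/triple_hom_eq/comp_assoc. Qed.

Definition triples : category :=
  Category triple_idl triple_idr triple_assoc.

End Triples.

Definition F_point (C : category) (one : terminal_object C) (A B : C)
    (j : Hom one B) : category :=
  @full (triples A B) (fun t =>
    [/\ strong_mono (tr_in t), epi (tr_down t) &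
        is_pullback (tr_down t) j (tr_in t) (to_one one A)]).

Definition F_cat (C : category) (A D B : C) (e : Hom A D) (m : Hom D B) :
    category :=
  @full (triples A B) (fun t =>
    epi (tr_down t) /\ is_pullback (tr_down t) m (tr_in t) e).

Section Conditions.
Variables (C : category) (one : terminal_object C).

Definition pullback_at_point_iso (X Y : C) (d : Hom X Y) (j : Hom one Y) :
    Prop :=
  exists (P : C) (p : Hom P X) (q : Hom P one),
    is_pullback d j p q /\ is_iso q.

Definition iso_off_one_point (X Y : C) (d : Hom X Y) : Prop :=
  forall j k : Hom one Y,
    ~ pullback_at_point_iso d j -> ~ pullback_at_point_iso d k -> j = k.

(* The first of the nine, a fixed terminal object, is the parameter [one]. *)
Record nine_axioms : Prop := NineAxioms {
  A2 : forall (X Y : C) (f : Hom X Y),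
    exists (Z : C) (e : Hom X Z) (m : Hom Z Y),
      [/\ epi e, strong_mono m & f = m ∘ e];
  A3 : forall (X Y B : C) (d : Hom X Y) (v : Hom B Y),
    epi d -> strong_mono v ->
    exists (P : C) (p : Hom P X) (q : Hom P B), is_pullback d v p q /\ epi q;
  A4 : forall (A X B : C) (u : Hom A X) (a : Hom A B),
    strong_mono u -> epi a ->
    exists (Y : C) (c : Hom X Y) (v : Hom B Y),
      [/\ is_pushout u a c v, strong_mono v & is_pullback c v u a];
  A5 : forall (A X B Y : C) (u : Hom A X) (a : Hom A B) (c : Hom X Y)
      (v : Hom B Y),
    strong_mono u -> epi a -> iso_off_one_point a -> is_pushout u a c v ->
    epi c /\ iso_off_one_point c;
  A6 : forall (A B : C) (j : Hom one B),
    exists t : F_point A j, is_terminal t;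
  A7_strong_mono : forall X : C,
    finite_set [set f : {A : C & Hom A X} | strong_mono (projT2 f)];
  A7_epi : forall X : C,
    finite_set [set f : {Y : C & Hom X Y} | epi (projT2 f)];
  A8 : forall (W X Y Z : C) (a : Hom W X) (b : Hom W Y) (c : Hom X Z)
      (d : Hom Y Z),
    strong_mono a -> strong_mono b -> strong_mono c -> strong_mono d ->
    c ∘ a = d ∘ b ->
    (exists h : Hom X Y, h ∘ a = b /\ d ∘ h = c) \/
    (exists k : Hom Y X, k ∘ b = a /\ c ∘ k = d);
  A9 : forall (X Y : C) (d : Hom X Y), epi d ->
    (forall j : Hom one Y, pullback_at_point_iso d j) -> is_identity d }.

End Conditions.

Section Functors.
Variables C D : category.

Record functor := Functor {
  fob :> C -> D;
  fmap : forall X Y : C, Hom X Y -> Hom (fob X) (fob Y);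
  fmap_id : forall X : C, fmap (idm X) = idm (fob X);
  fmap_comp : forall (X Y Z : C) (g : Hom Y Z) (f : Hom X Y),
    fmap (g ∘ f) = fmap g ∘ fmap f }.

Definition category_isomorphism (R : functor) : Prop :=
  bijective (fob R) /\ forall X Y : C, bijective (@fmap R X Y).

End Functors.

Section Trees.
Variables (L : Type) (ar : L -> nat).

Inductive tree : Type :=
| leaf : tree
| node (l : L) (ch : 'I_(ar l) -> tree) : tree.

(* Addresses are words of input places, which are counted from 0. *)
Fixpoint is_pos (X : tree) (a : seq nat) {struct a} : bool :=
  match a, X with
  | [::], _ => true
  | p :: b, node l ch => if insub p is Some i then is_pos (ch i) b else false
  | _ :: _, leaf => false
  end.

(* [subtree X a] is only meaningful when [is_pos X a]. *)
Fixpoint subtree (X : tree) (a : seq nat) {struct a} : tree :=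
  match a, X with
  | [::], _ => X
  | p :: b, node l ch => if insub p is Some i then subtree (ch i) b else leaf
  | _ :: _, leaf => leaf
  end.

(* [X] with its subtree at position [a] replaced by [S]. *)
Fixpoint replace_at (X : tree) (a : seq nat) (S : tree) {struct a} : tree :=
  match a, X with
  | [::], _ => S
  | p :: b, node l ch =>
      node (fun i : 'I_(ar l) =>
              if i == p :> nat then replace_at (ch i) b S else ch i)
  | _ :: _, leaf => leaf
  end.

(* [prunes X T]: [T] is obtainable from [X] by pruning. A pruning map is
   determined by its source and target, so this proposition also plays the
   role of the pruning map [X -> T]. *)
Inductive prunes : tree -> tree -> Prop :=
| PrunesLeaf X : prunes X leaf
| PrunesNode l (ch ch' : 'I_(ar l) -> tree) :
    (forall p, prunes (ch p) (ch' p)) -> prunes (node ch) (node ch').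

(* The longest prefix of [a] which is a position of [T]. *)
Fixpoint longest_prefix (T : tree) (a : seq nat) {struct a} : seq nat :=
  match a, T with
  | p :: b, node l ch =>
      if insub p is Some i then p :: longest_prefix (ch i) b else [::]
  | _, _ => [::]
  end.

Record tree_hom (X Y : tree) := TreeHom {
  th_mid : tree;
  th_addr : seq nat;
  th_prunes : prunes X th_mid;
  th_occ : is_pos Y th_addr /\ subtree Y th_addr = th_mid }.

Lemma tree_hom_eq X Y (f g : tree_hom X Y) : th_addr f = th_addr g -> f = g.
Proof.
case: f g => [T a d hu] [T' a' d' hu'] /= E; subst a'.
have ET : T = T' by case: hu hu' => [_ <-] [].
by subst T'; rewrite (Prop_irrelevance d' d) (Prop_irrelevance hu' hu).
Qed.

Lemma subtree_leaf a : subtree leaf a = leaf.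
Proof. by case: a. Qed.

Lemma is_pos_cat X a b : is_pos X (a ++ b) = is_pos X a && is_pos (subtree X a) b.
Proof.
elim: a X => [|p a IH] [|l ch] //=.
by case: insubP => [i _ _|_] //=.
Qed.

Lemma subtree_cat X a b : subtree X (a ++ b) = subtree (subtree X a) b.
Proof.
elim: a X => [|p a IH] [|l ch] //=; first by rewrite subtree_leaf.
by case: insubP => [i _ _|_] //=; rewrite subtree_leaf.
Qed.

Lemma is_pos_longest_prefix T a : is_pos T (longest_prefix T a).
Proof.
elim: a T => [|p a IH] [|l ch] //=.
by case E: (insub p) => [i|] //=; rewrite E IH.
Qed.

Lemma longest_prefix_id T a : is_pos T a -> longest_prefix T a = a.
Proof.
elim: a T => [|p a IH] [|l ch] //=.
by case: (insub p) => [i|] // /IH ->.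
Qed.

Lemma longest_prefix_leaf a : longest_prefix leaf a = [::].
Proof. by case: a. Qed.

Lemma prunes_refl X : prunes X X.
Proof. by elim: X => [|l ch IH]; constructor. Qed.

Lemma prunes_from_leaf T : prunes leaf T -> T = leaf.
Proof.
move=> H; move: (erefl (@leaf)); move: {1 3}leaf H => X H.
by case: H.
Qed.

Lemma prunes_from_node l (ch : 'I_(ar l) -> tree) T :
  prunes (node ch) T ->
  T = leaf \/ exists2 ch', T = node ch' & forall p, prunes (ch p) (ch' p).
Proof.
move=> H.
pose P (X Y : tree) := match X with
  | leaf => True
  | node l ch => Y = leaf \/
      exists2 ch', Y = node ch' & forall p : 'I_(ar l), prunes (ch p) (ch' p)
  end.
suff : P (node ch) T by [].
by case: H => [[|l1 ch1]|l1 ch1 ch2 H] //=; [left | right; exists ch2].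
Qed.

Lemma prunes_trans Y X Z : prunes X Y -> prunes Y Z -> prunes X Z.
Proof.
move=> H; elim: H Z => {X Y} [X|l ch ch' _ IH] Z.
  by move=> /prunes_from_leaf ->; constructor.
case/prunes_from_node => [->|[ch2 -> H]]; first by constructor.
by constructor => p; apply: IH.
Qed.

Lemma prunes_subtree Y S a : prunes Y S -> is_pos Y a ->
  prunes (subtree Y a) (subtree S (longest_prefix S a)).
Proof.
elim: a Y S => [|p a IH] [|l ch] S //=.
case/prunes_from_node => [->|[ch' -> H]] /=; first by move=> _; constructor.
case E: (insub p) => [i|] //= ia.
by rewrite E; apply: IH.
Qed.

Lemma longest_prefix_prunes Z V a : prunes Z V ->
  longest_prefix V (longest_prefix Z a) = longest_prefix V a.
Proof.
elim: a Z V => [|p a IH] [|l ch] V //=; first by move/prunes_from_leaf ->.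
case/prunes_from_node => [->|[ch' -> H]] /=; first by rewrite longest_prefix_leaf.
by case E: (insub p) => [i|] //=; rewrite E IH.
Qed.

Lemma longest_prefix_cat Z V a b : prunes Z V -> is_pos Z b ->
  longest_prefix V (b ++ longest_prefix (subtree Z b) a) =
  longest_prefix V b ++ longest_prefix (subtree V (longest_prefix V b)) a.
Proof.
elim: b Z V => [|p b IH] Z V /=; first by case: V => [|l ch] /longest_prefix_prunes.
case: Z => [|l ch] //.
case/prunes_from_node => [->|[ch' -> H]] /=; first by rewrite longest_prefix_leaf.
case E: (insub p) => [i|] //= ib.
by rewrite E IH.
Qed.

Section Composition.
Variables X Y Z : tree.
Variables (g : tree_hom Y Z) (f : tree_hom X Y).

Let S := th_mid g.
Let a' := longest_prefix S (th_addr f).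

Lemma tree_comp_prunes : prunes X (subtree S a').
Proof.
apply: prunes_trans (th_prunes f) _; have [posa <-] := th_occ f.
exact: prunes_subtree (th_prunes g) posa.
Qed.

Lemma tree_comp_occ : is_pos Z (th_addr g ++ a') /\
  subtree Z (th_addr g ++ a') = subtree S a'.
Proof.
have [posb Eb] := th_occ g.
by rewrite is_pos_cat subtree_cat Eb posb is_pos_longest_prefix.
Qed.

Definition tree_comp : tree_hom X Z := TreeHom tree_comp_prunes tree_comp_occ.

End Composition.

Definition tree_id (X : tree) : tree_hom X X :=
  @TreeHom X X X [::] (prunes_refl X) (conj isT erefl).

Lemma tree_idl X Y (f : tree_hom X Y) : tree_comp (tree_id Y) f = f.
Proof. by apply/tree_hom_eq/longest_prefix_id; case: (th_occ f). Qed.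

Lemma tree_idr X Y (f : tree_hom X Y) : tree_comp f (tree_id X) = f.
Proof. by apply: tree_hom_eq; rewrite /= cats0. Qed.

Lemma tree_comp_assoc W X Y Z (h : tree_hom Y Z) (g : tree_hom X Y)
    (f : tree_hom W X) :
  tree_comp h (tree_comp g f) = tree_comp (tree_comp h g) f.
Proof.
apply: tree_hom_eq => /=; rewrite -catA; congr (_ ++ _).
have [posb Eb] := th_occ g.
by rewrite -Eb; apply: longest_prefix_cat (th_prunes h) posb.
Qed.

End Trees.

Arguments leaf {L ar}.

Definition tree_category (L : Type) (ar : L -> nat) : category :=
  Category (@tree_idl L ar) (@tree_idr L ar) (@tree_comp_assoc L ar).

Definition is_pruning_map (L : Type) (ar : L -> nat) (X Y : tree ar)
    (f : tree_hom X Y) : Prop := th_addr f = [::].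

Definition is_occurrence (L : Type) (ar : L -> nat) (X Y : tree ar)
    (f : tree_hom X Y) : Prop := th_mid f = X.

Section Representation.
Variables (C : category) (one : terminal_object C).

Definition indecomposable (A X : C) (i : Hom A X) : Prop :=
  [/\ strong_mono i, ~ is_identity i &
      forall (Y : C) (u : Hom A Y) (v : Hom Y X),
        strong_mono u -> strong_mono v -> i = v ∘ u ->
        is_identity u \/ is_identity v].

Record component (X : C) := Component {
  dom : C;
  arr : Hom dom X;
  arrP : indecomposable arr }.

Definition in_Eo (X Y : C) (f : Hom X Y) : Prop :=
  (epi f /\ Y <> one) \/ (is_identity f /\ Y = one).

Definition normal (X : C) : Prop :=
  forall (Y : C) (f : Hom X Y), in_Eo f -> is_identity f.

Record label := Label {
  lab_ob :> C;
  lab_normal : normal lab_ob;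
  lab_neq1 : lab_ob <> one }.

(* The bijections make [ar phi] the cardinality of Comp(phi). *)
Record numbering := Numbering {
  ar : label -> nat;
  input : forall phi : label, 'I_(ar phi) -> component phi;
  input_bij : forall phi : label, bijective (@input phi) }.

(* [k] is the strong monomorphism part of [rho ∘ i]. *)
Definition corresponds (X N : C) (rho : Hom X N) (i : component X)
    (k : component N) : Prop :=
  exists e : Hom (dom i) (dom k), epi e /\ rho ∘ arr i = arr k ∘ e.

Variable num : numbering.

(* A morphism [rho] in E° from [X] to a label [phi] has a normal target, so it
   is the morphism ρ_X, and [phi] is r(X). *)
Definition tree_map (T : C -> tree (ar num)) : Prop :=
  T one = leaf /\
  forall X : C, X <> one ->
    exists (phi : label) (rho : Hom X phi) (ch : 'I_(ar num phi) -> tree (ar num)),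
      [/\ in_Eo rho, T X = node ch &
          forall p, exists i : component X,
            corresponds rho i (input p) /\ ch p = T (dom i)].

(* The word [a] lists the input places from the codomain of [m] downwards, so
   its first letter belongs to the last component of the composite. *)
Inductive input_path : forall A X : C, Hom A X -> seq nat -> Prop :=
| PathId (X : C) : input_path (idm X) [::]
| PathStep (X A : C) (phi : label) (rho : Hom X phi) (p : 'I_(ar num phi))
    (i : component X) (m : Hom A (dom i)) (a : seq nat) :
    in_Eo rho -> corresponds rho i (input p) -> input_path m a ->
    input_path (arr i ∘ m) (val p :: a).

Definition representation (R : functor C (tree_category (ar num))) : Prop :=
  [/\ category_isomorphism R,
      tree_map (fob R),
      forall (X Y : C) (f : Hom X Y), epi f -> is_pruning_map (fmap R f) &
      forall (X Y : C) (f : Hom X Y), strong_mono f ->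
        is_occurrence (fmap R f) /\ input_path f (th_addr (fmap R f))].

End Representation.

(* Main.v *)
(* Isomorphisms are identities (A9). Call the fibre of an epimorphism over a point
   trivial if it is a point. Let [v : 1 -> B/D] be the pushout of [D -> 1] along [m].
   An object of F(D, v) is terminal exactly when its fibres at all points other
   than [v] are trivial; by (A5), [B] is such an object. If [K -> B/D] is terminal
   in F(A, v), its pushout along [e] is terminal in F(D, v), hence equal to [B], and
   the resulting [K -> B] is terminal in F(e, m), with trivial fibres at all points
   outside [m]. The nodes of the trees are governed by the fact that, if a strong
   monomorphism [s] followed by an epimorphism [d] is an epimorphism, then [s] is
   an identity or the codomain of [d] is 1: hence epimorphisms with codomain other
   than 1 induce bijections on components, and normal forms are unique. *)
Require Import Defs.
From mathcomp Require Import all_boot.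
From mathcomp Require Import boolp classical_sets functions cardinality.
Set Implicit Arguments.
Unset Strict Implicit.
Unset Printing Implicit Defensive.
Local Open Scope cat_scope.

Lemma existT_inj (I : Type) (F : I -> Type) (i : I) (x y : F i) :
  existT F i x = existT F i y -> x = y.
Proof.
by move=> E; have := projT2_eq E; rewrite (Prop_irrelevance (projT1_eq E) erefl).
Qed.

(** * Well-foundedness from strictly shrinking finite sets *)

Section WellFounded.
Local Open Scope classical_set_scope.
Variables (I : Type) (R : I -> I -> Prop) (F : I -> Type).
Variable P : forall i, set (F i).
Arguments P : clear implicits.

(** A step down along [R] embeds [P i'] into [P i] and misses [z], so the finite set shrinks. The
    induction is on a bound for an injective numbering [g] of [P i]. *)
Lemma wf_finite_inj :
  (forall i, finite_set (P i)) ->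
  (forall i' i, R i' i -> exists f : F i' -> F i,
     [/\ forall x, P i' x -> P i (f x),
         forall x y, P i' x -> P i' y -> f x = f y -> x = y &
         exists2 z, P i z & forall x, P i' x -> f x <> z]) ->
  well_founded R.
Proof.
move=> finP RP i.
have [n /card_set_bijP[g [gn ginj _]]] := finP i.
have {}gn x : P i x -> (g x < n)%N by move=> Px; apply: gn.
have {ginj} : forall x y, P i x -> P i y -> g x = g y -> x = y.
  by move=> x y Px Py; apply: ginj; rewrite inE.
elim: n i g gn => [|n IH] i g gn ginj; constructor=> i' /RP[f [fP finj [z Pz fz]]].
  by have := gn _ Pz.
have gfz x : P i' x -> g (f x) != g z.
  by move=> Px; apply/eqP => /(ginj _ _ (fP _ Px) Pz)/fz; apply.
(* The value [g z] is not taken on the image of [f]; [unbump] closes that gap, so the new numbering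
   stays below [n]. *)
apply: (IH i' (fun x => unbump (g z) (g (f x)))) => [x Px|x y Px Py E].
  have := gn _ (fP _ Px); have := gn _ Pz; have := gfz _ Px; rewrite /unbump.
  case: (ltngtP (g z) (g (f x))) => //= lt _ gz gfx; last first.
    by rewrite subn0 (leq_trans lt).
  by rewrite subn1 -ltnS prednK // (leq_ltn_trans _ lt).
apply: finj => //; apply: ginj; [exact: fP | exact: fP|].
by rewrite -(unbumpK (gfz x Px)) E unbumpK //; apply: gfz.
Qed.

End WellFounded.

(** * Epimorphisms, strong monomorphisms, pullbacks and pushouts in any category *)

Section Arrows.
Variable C : category.
Implicit Types A B D X Y Z W P Q : C.

Lemma is_identity_ob X Y (f : Hom X Y) : is_identity f -> X = Y.
Proof. by case. Qed.

Lemma is_identity_iso X Y (f : Hom X Y) : is_identity f -> is_iso f.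
Proof. by case=> Z; exists (idm Z); rewrite comp_idl. Qed.

Lemma iso_epi X Y (f : Hom X Y) : is_iso f -> epi f.
Proof.
by case=> g [_ fg] Z h k E; rewrite -(comp_idr h) -fg comp_assoc E -comp_assoc fg
  comp_idr.
Qed.

Lemma is_identity_epi X Y (f : Hom X Y) : is_identity f -> epi f.
Proof. by move/is_identity_iso/iso_epi. Qed.

Lemma epi_comp X Y Z (g : Hom Y Z) (f : Hom X Y) : epi g -> epi f -> epi (g ∘ f).
Proof. by move=> eg ef W h k; rewrite !comp_assoc => /ef/eg. Qed.

Lemma epi_cancel X Y Z (g : Hom Y Z) (f : Hom X Y) : epi (g ∘ f) -> epi g.
Proof. by move=> e W h k E; apply: e; rewrite !comp_assoc E. Qed.

Lemma split_strong_mono X Y (s : Hom X Y) (r : Hom Y X) :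
  r ∘ s = idm X -> strong_mono s.
Proof.
move=> rs; split=> [Z g h E|P Q e a b ee E].
  by rewrite -(comp_idl g) -(comp_idl h) -rs -!comp_assoc E.
have le : (r ∘ b) ∘ e = a by rewrite -comp_assoc -E comp_assoc rs comp_idl.
by exists (r ∘ b); split=> //; apply: ee; rewrite -comp_assoc le.
Qed.

Lemma iso_strong_mono X Y (f : Hom X Y) : is_iso f -> strong_mono f.
Proof. by case=> g [/split_strong_mono]. Qed.

Lemma strong_mono_comp X Y Z (g : Hom Y Z) (f : Hom X Y) :
  strong_mono g -> strong_mono f -> strong_mono (g ∘ f).
Proof.
move=> [mg sg] [mf sf]; split=> [W h k|P Q e a b ee].
  by rewrite -!comp_assoc => /mg/mf.
rewrite -comp_assoc => /(sg _ _ _ _ _ ee)[l [le gl]].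
have [l' [l'e fl']] := sf _ _ _ _ _ ee (esym le).
by exists l'; rewrite -comp_assoc fl'.
Qed.

Lemma strong_mono_cancel X Y Z (g : Hom Y Z) (f : Hom X Y) :
  strong_mono (g ∘ f) -> strong_mono f.
Proof.
move=> [mgf sgf]; split=> [W h k E|P Q e a b ee E].
  by apply: mgf; rewrite -!comp_assoc E.
have [|l [le _]] := sgf _ _ _ a (g ∘ b) ee; first by rewrite -!comp_assoc E.
by exists l; split=> //; apply: ee; rewrite -comp_assoc le.
Qed.

Lemma epi_strong_mono_iso X Y (f : Hom X Y) : epi f -> strong_mono f -> is_iso f.
Proof.
move=> ef [_ /(_ _ _ f (idm X) (idm Y) ef)[|l [lf fl]]].
  by rewrite comp_idr comp_idl.
by exists l.
Qed.

Lemma pullback_monoI X Y Z P (f : Hom X Z) (g : Hom Y Z) (p : Hom P X)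
    (q : Hom P Y) : mono g -> mono p -> f ∘ p = g ∘ q ->
  (forall W (x : Hom W X) (y : Hom W Y), f ∘ x = g ∘ y ->
     exists h : Hom W P, p ∘ h = x) ->
  is_pullback f g p q.
Proof.
move=> mg mp E U; split=> // W x y Exy; have [h ph] := U _ _ _ Exy.
exists h; split=> [|h' [ph' _]]; last by apply: mp; rewrite ph ph'.
by split=> //; apply: mg; rewrite comp_assoc -E -comp_assoc ph.
Qed.

Lemma pullback_factor X Y Z P (f : Hom X Z) (g : Hom Y Z) (p : Hom P X)
    (q : Hom P Y) : is_pullback f g p q ->
  forall W (x : Hom W X) (y : Hom W Y), f ∘ x = g ∘ y ->
  exists h : Hom W P, p ∘ h = x /\ q ∘ h = y.
Proof. by move=> [_ U] W x y /U[h [hh _]]; exists h. Qed.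

Lemma pullback_mono X Y Z P (f : Hom X Z) (g : Hom Y Z) (p : Hom P X)
    (q : Hom P Y) : is_pullback f g p q -> mono g -> mono p.
Proof.
move=> [E U] mg W h k phk.
have [|l [_ lU]] := U W (p ∘ h) (q ∘ h); first by rewrite !comp_assoc E.
rewrite -(lU h) // (lU k) //; split=> //.
by apply: mg; rewrite !comp_assoc -E -!comp_assoc phk.
Qed.

Lemma pullback_strong_mono X Y Z P (f : Hom X Z) (g : Hom Y Z) (p : Hom P X)
    (q : Hom P Y) : is_pullback f g p q -> strong_mono g -> strong_mono p.
Proof.
move=> pb [mg sg]; have mp := pullback_mono pb mg; split=> // S T e a b ee E.
have [|l [le gl]] := sg S T e (q ∘ a) (f ∘ b) ee.
  by rewrite comp_assoc -(proj1 pb) -!comp_assoc E.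
have [h [ph _]] := pullback_factor pb (esym gl).
by exists h; split=> //; apply: mp; rewrite comp_assoc ph.
Qed.

Lemma pullback_iso X Y Z P P' (f : Hom X Z) (g : Hom Y Z) (p : Hom P X)
    (q : Hom P Y) (h : Hom P' P) :
  is_iso h -> is_pullback f g p q -> is_pullback f g (p ∘ h) (q ∘ h).
Proof.
move=> [h' [h'h hh']] [E U]; split=> [|W x y /U[l [[pl ql] lU]]].
  by rewrite !comp_assoc E.
have hl : h ∘ (h' ∘ l) = l by rewrite comp_assoc hh' comp_idl.
exists (h' ∘ l); split=> [|k [pk qk]]; first by rewrite -!comp_assoc hl.
by rewrite (lU (h ∘ k)) ?comp_assoc // h'h comp_idl.
Qed.

Lemma pullback_id X Y (f : Hom X Y) : is_pullback f (idm Y) (idm X) f.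
Proof.
split=> [|W x y E]; first by rewrite comp_idl comp_idr.
exists x; split=> [|h [<- _]]; last by rewrite comp_idl.
by rewrite E !comp_idl.
Qed.

Lemma pullback_unique X Y Z P P' (f : Hom X Z) (g : Hom Y Z) (p : Hom P X)
    (q : Hom P Y) (p' : Hom P' X) (q' : Hom P' Y) :
  is_pullback f g p q -> is_pullback f g p' q' ->
  exists h : Hom P P', [/\ is_iso h, p' ∘ h = p & q' ∘ h = q].
Proof.
move=> pb pb'; have [h [ph qh]] := pullback_factor pb' (proj1 pb).
have [k [pk qk]] := pullback_factor pb (proj1 pb').
exists h; split=> //; exists k; split.
  have [l [_ lU]] := proj2 pb _ _ _ (proj1 pb).
  rewrite -(lU (k ∘ h)); last by rewrite !comp_assoc pk qk.
  by apply: lU; rewrite !comp_idr.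
have [l [_ lU]] := proj2 pb' _ _ _ (proj1 pb').
rewrite -(lU (h ∘ k)); last by rewrite !comp_assoc ph qh.
by apply: lU; rewrite !comp_idr.
Qed.

Lemma pullback_paste X X' Y Z P P' (f : Hom X Z) (g : Hom Y Z) (p : Hom P X)
    (q : Hom P Y) (f' : Hom X' X) (p' : Hom P' X') (q' : Hom P' P) :
  is_pullback f g p q -> is_pullback f' p p' q' ->
  is_pullback (f ∘ f') g p' (q ∘ q').
Proof.
move=> pb pb'; split=> [|W x y E].
  by rewrite -comp_assoc (proj1 pb') !comp_assoc (proj1 pb).
have [|h [[ph qh] hU]] := proj2 pb W (f' ∘ x) y; first by rewrite comp_assoc.
have [h' [[ph' qh'] hU']] := proj2 pb' W x h (esym ph).
exists h'; split=> [|k [pk qk]]; first by rewrite -comp_assoc qh'.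
apply: hU'; split=> //; apply/esym/hU; split; last by rewrite comp_assoc.
by rewrite comp_assoc -(proj1 pb') -comp_assoc pk.
Qed.

(** Converse of pasting: the arrow induced by the outer rectangle has second projection [y] because
    [p] is monic and both sides agree after [p]. *)
Lemma pullback_cancel X X' Y Z P P' (f : Hom X Z) (g : Hom Y Z) (p : Hom P X)
    (q : Hom P Y) (f' : Hom X' X) (p' : Hom P' X') (q' : Hom P' P) :
  mono p -> is_pullback (f ∘ f') g p' (q ∘ q') -> f ∘ p = g ∘ q -> f' ∘ p' = p ∘ q' ->
  is_pullback f' p p' q'.
Proof.
move=> mp pb E E'; split=> // W x y Exy.
have [|h [[ph qh] hU]] := proj2 pb W x (q ∘ y).
  by rewrite -comp_assoc Exy !comp_assoc E.
exists h; split=> [|k [pk qk]].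
  by split=> //; apply: mp; rewrite comp_assoc -E' -comp_assoc ph.
by apply: hU; rewrite -comp_assoc qk.
Qed.

Lemma pushout_factor X Y Z P (f : Hom Z X) (g : Hom Z Y) (p : Hom X P)
    (q : Hom Y P) : is_pushout f g p q ->
  forall W (x : Hom X W) (y : Hom Y W), x ∘ f = y ∘ g ->
  exists h : Hom P W, h ∘ p = x /\ h ∘ q = y.
Proof. by move=> [_ U] W x y /U[h [hh _]]; exists h. Qed.

Lemma pushout_epi X Y Z P (f : Hom Z X) (g : Hom Z Y) (p : Hom X P)
    (q : Hom Y P) : is_pushout f g p q -> epi g -> epi p.
Proof.
move=> [E U] eg W h k hkp.
have [|l [_ lU]] := U W (h ∘ p) (h ∘ q); first by rewrite -!comp_assoc E.
rewrite -(lU h) // (lU k) //; split=> //.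
by apply: eg; rewrite -!comp_assoc -E !comp_assoc hkp.
Qed.

Lemma pushout_iso X Y Z P P' (f : Hom Z X) (g : Hom Z Y) (p : Hom X P)
    (q : Hom Y P) (h : Hom P P') :
  is_iso h -> is_pushout f g p q -> is_pushout f g (h ∘ p) (h ∘ q).
Proof.
move=> [h' [h'h hh']] [E U]; split=> [|W x y /U[l [[lp lq] lU]]].
  by rewrite -!comp_assoc E.
have lh : (l ∘ h') ∘ h = l by rewrite -comp_assoc h'h comp_idr.
exists (l ∘ h'); split=> [|k [kp kq]]; first by rewrite !comp_assoc lh.
by rewrite (lU (k ∘ h)) -?comp_assoc // hh' comp_idr.
Qed.

Lemma pushout_of_iso X Y Z P (f : Hom Z X) (g : Hom Z Y) (p : Hom X P)
    (q : Hom Y P) : is_pushout f g p q -> is_iso g -> is_iso p.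
Proof.
move=> po [g' [g'g gg']].
have [|h [hp hq]] := pushout_factor po (x := idm X) (y := f ∘ g').
  by rewrite -comp_assoc g'g comp_idl comp_idr.
exists h; split=> //.
have ep : epi p by apply: pushout_epi po _; apply: iso_epi; exists g'.
by apply: ep; rewrite -comp_assoc hp comp_idl comp_idr.
Qed.

End Arrows.

(** * Fibres over points *)

Section NineAxioms.
Variables (C : category) (one : terminal_object C).
Hypothesis ax : nine_axioms one.
Implicit Types A B D X Y Z W P Q : C.

Lemma to_one_eq X (f g : Hom X one) : f = g.
Proof. by rewrite (to_one_unique f) (to_one_unique g). Qed.

Lemma point_strong_mono X (j : Hom one X) : strong_mono j.
Proof. by apply: (@split_strong_mono _ _ _ j (to_one one X)); apply: to_one_eq. Qed.

(* The fibre of [d] over [j] is a point, without reference to a pullback. *)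
Definition trivial_fibre X Y (d : Hom X Y) (j : Hom one Y) : Prop :=
  exists2 p : Hom one X, d ∘ p = j &
    forall W (x : Hom W X), d ∘ x = j ∘ to_one one W -> x = p ∘ to_one one W.

Lemma trivial_fibreP X Y (d : Hom X Y) (j : Hom one Y) :
  pullback_at_point_iso d j <-> trivial_fibre d j.
Proof.
split=> [[P [p [q [pb [q' [q'q qq']]]]]]|[p dp U]].
  exists (p ∘ q'); first by rewrite comp_assoc (proj1 pb) -comp_assoc qq' comp_idr.
  move=> W x /(pullback_factor pb)[h [<- <-]].
  by rewrite -comp_assoc (comp_assoc q') q'q comp_idl.
exists one, p, (idm one); split; last exact: is_identity_iso.
split=> [|W x y E]; first by rewrite comp_idr.
have {}E : x = p ∘ to_one one W by apply: U; rewrite E; congr (_ ∘ _); apply: to_one_eq.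
by exists (to_one one W); split=> [|k _]; [split=> //|]; apply: to_one_eq.
Qed.

Lemma iso_trivial_fibre X Y (d : Hom X Y) (j : Hom one Y) :
  is_iso d -> trivial_fibre d j.
Proof.
case=> d' [d'd dd']; exists (d' ∘ j) => [|W x E];
  first by rewrite comp_assoc dd' comp_idl.
by rewrite -comp_assoc -E comp_assoc d'd comp_idl.
Qed.

Lemma trivial_fibres_identity X Y (d : Hom X Y) :
  epi d -> (forall j, trivial_fibre d j) -> is_identity d.
Proof. by move=> ed dj; apply: (A9 ax) => // j; apply/trivial_fibreP. Qed.

Lemma iso_identity X Y (f : Hom X Y) : is_iso f -> is_identity f.
Proof.
by move=> fi; apply: trivial_fibres_identity (iso_epi fi) _ => j;
  apply: iso_trivial_fibre.
Qed.

Lemma epi_strong_mono_identity X Y (f : Hom X Y) :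
  epi f -> strong_mono f -> is_identity f.
Proof. by move=> ef sf; apply: iso_identity; apply: epi_strong_mono_iso. Qed.

Lemma epi_pullback X Y B P (d : Hom X Y) (v : Hom B Y) (p : Hom P X) (q : Hom P B) :
  epi d -> strong_mono v -> is_pullback d v p q -> epi q.
Proof.
move=> ed sv pb; have [P' [p' [q' [pb' eq']]]] := A3 ax ed sv.
have [h [hi _ <-]] := pullback_unique pb pb'.
by apply: epi_comp => //; apply: iso_epi.
Qed.

(** This is (A6); the strength of [u'] that it asks for is automatic, [u'] being a pullback of a
    point. *)
Lemma terminal_graft A B (j : Hom one B) : exists K (d : Hom K B) (u : Hom A K),
  [/\ strong_mono u, epi d, is_pullback d j u (to_one one A) &
      forall K' (d' : Hom K' B) (u' : Hom A K'), epi d' ->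
        is_pullback d' j u' (to_one one A) ->
        exists! h : Hom K' K, h ∘ u' = u /\ d ∘ h = d'].
Proof.
have [[[K d u] [/= su ed pb]] U] := A6 ax A j.
exists K, d, u; split=> // K' d' u' ed' pb'.
have su' := pullback_strong_mono pb' (point_strong_mono j).
have [[h hh] hU] := U (exist _ (@Triple _ A B K' d' u') (And3 su' ed' pb')).
exists h; split=> // k hk.
by have := hU (exist _ k hk) => /(congr1 sval).
Qed.

(** (A6) over the point [idm one] exhibits [to_one one X] as a pullback of an epimorphism along a
    point, so (A3) applies. *)
Lemma to_one_epi X : epi (to_one one X).
Proof.
have [K [d [u [_ ed pb _]]]] := terminal_graft X (idm one).
exact: epi_pullback ed (point_strong_mono _) pb.
Qed.

Lemma point_epi X (j : Hom one X) : epi j -> X = one.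
Proof.
by move=> ej; apply/esym/(is_identity_ob (epi_strong_mono_identity ej
  (point_strong_mono j))).
Qed.

Lemma point_fibre X Y (d : Hom X Y) (j : Hom one Y) : epi d ->
  exists F (f : Hom F X), strong_mono f /\ is_pullback d j f (to_one one F).
Proof.
move=> ed; have [F [f [q [pb _]]]] := A3 ax ed (point_strong_mono j).
exists F, f; split; first exact: pullback_strong_mono pb (point_strong_mono j).
by rewrite (to_one_unique q) in pb.
Qed.

(** The fibre of [d] over [k] lies in that of [z ∘ d] over [z ∘ k], hence is constant at [p]. That
    [p] lies over [k] follows by cancelling the epimorphism from the fibre to [one]. *)
Lemma trivial_fibre_cancel X Y Z (d : Hom X Y) (z : Hom Y Z) (k : Hom one Y) :
  epi d -> trivial_fibre (z ∘ d) (z ∘ k) -> trivial_fibre d k.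
Proof.
move=> ed [p zdp U]; have [F [f [_ pb]]] := point_fibre k ed.
have Ef : f = p ∘ to_one one F.
  by apply: U; rewrite -comp_assoc (proj1 pb) comp_assoc.
exists p => [|W x E]; last by apply: U; rewrite -!comp_assoc E.
by apply: (@to_one_epi F); rewrite -comp_assoc -Ef (proj1 pb).
Qed.

(** By (A3) the fibre of [z ∘ d] maps epimorphically onto the fibre of [z], so the latter is
    constant as soon as the former is. *)
Lemma trivial_fibre_epi X Y Z (d : Hom X Y) (z : Hom Y Z) (j : Hom one Z) :
  epi d -> epi z -> trivial_fibre (z ∘ d) j -> trivial_fibre z j.
Proof.
move=> ed ez [p zdp U]; exists (d ∘ p) => [|W x E]; first by rewrite comp_assoc.
have [F [f [sf pb]]] := point_fibre j ez.
have [h [<- _]] := pullback_factor pb E.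
have [G [g [q [pb' eq]]]] := A3 ax ed sf.
have Eg : g = p ∘ to_one one G.
  by apply: U; rewrite -comp_assoc (proj1 pb') comp_assoc (proj1 pb) -comp_assoc;
    congr (_ ∘ _); apply: to_one_eq.
have -> : f = (d ∘ p) ∘ to_one one F.
  apply: eq; rewrite -(proj1 pb') Eg -!comp_assoc; congr (_ ∘ (_ ∘ _)).
  exact: to_one_eq.
by rewrite -!comp_assoc; congr (_ ∘ (_ ∘ _)); apply: to_one_eq.
Qed.

Lemma trivial_fibre_pullback X Y B P (d : Hom X Y) (v : Hom B Y) (p : Hom P X)
    (q : Hom P B) (k : Hom one B) : mono v ->
  is_pullback d v p q -> trivial_fibre d (v ∘ k) -> trivial_fibre q k.
Proof.
move=> mv pb [x dx U]; have [h [ph qh]] := pullback_factor pb dx.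
exists h => // W w qw; apply: (pullback_mono pb mv).
by rewrite comp_assoc ph; apply: U; rewrite comp_assoc (proj1 pb) -!comp_assoc qw.
Qed.

(* By (A8) each fibre of [r] is comparable with [v]: either it lies in [Y], hence
   is a point, or it contains [Y], and then [id = r v] factors through a point. *)
Lemma section_identity Y Y' (v : Hom Y Y') (r : Hom Y' Y) :
  r ∘ v = idm Y -> Y = one \/ is_identity v.
Proof.
move=> rv; have sv := split_strong_mono rv.
have er : epi r by apply: (@epi_cancel _ _ _ _ _ v); rewrite rv; apply: is_identity_epi.
have [Y1|nY] := pselect (Y = one); first by left.
right.
suff /is_identity_iso[r' [r'r _]] : is_identity r.
  apply: iso_identity; exists r; split=> //.
  by rewrite -[v ∘ r]comp_idl -{1}r'r -comp_assoc (comp_assoc r v) rv comp_idl.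
apply: trivial_fibres_identity => // j.
have [F [f [sf pb]]] := point_fibre j er.
have [|p [fp _]] := pullback_factor pb (x := v ∘ j) (y := idm one).
  by rewrite comp_assoc rv comp_idl comp_idr.
have [[h [_ fh]]|[k [_ vk]]] := A8 ax (point_strong_mono j) (point_strong_mono p)
  sv sf (esym fp).
  case: nY; apply: (point_epi (j := j));
    apply: (@epi_cancel _ _ _ _ _ (to_one one F ∘ h)).
  rewrite comp_assoc -(proj1 pb) -comp_assoc fh rv; exact: is_identity_epi.
have Ek : k = j ∘ to_one one F by rewrite -(proj1 pb) -vk comp_assoc rv comp_idl.
exists (v ∘ j) => [|W x /(pullback_factor pb)[l [<- _]]].
  by rewrite comp_assoc rv comp_idl.
by rewrite -vk Ek -!comp_assoc; congr (_ ∘ (_ ∘ _)); apply: to_one_eq.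
Qed.

(** In the pushout of [s] and [d ∘ s], the map induced by [d] retracts [v], so [section_identity]
    applies to [v]. If [v] is invertible, so is its pullback [s]. *)
Lemma strong_mono_onto I X Y (s : Hom I X) (d : Hom X Y) :
  strong_mono s -> epi (d ∘ s) -> Y = one \/ is_identity s.
Proof.
move=> ss eds; have [Q [c [v [po sv pb]]]] := A4 ax ss eds.
have [|r [rc rv]] := pushout_factor po (x := d) (y := idm Y); first by rewrite comp_idl.
have [|/is_identity_iso[v' [v'v vv']]] := section_identity rv; [by left | right].
apply: iso_identity.
have [|h [sh _]] := pullback_factor pb (x := idm X) (y := v' ∘ c).
  by rewrite comp_assoc vv' comp_idl comp_idr.
exists h; split=> //; apply: (proj1 ss).
by rewrite comp_assoc sh comp_idl comp_idr.
Qed.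

(** * Grafting *)

(** (A5) leaves at most one nontrivial fibre of the contraction of [S]. If the fibre over [v] is
    trivial instead, then [S] is a point and [c] is an isomorphism. *)
Lemma collapse S X (s : Hom S X) : strong_mono s ->
  exists Q (c : Hom X Q) (v : Hom one Q),
    [/\ epi c, is_pushout s (to_one one S) c v, is_pullback c v s (to_one one S) &
        forall j, j <> v -> trivial_fibre c j].
Proof.
move=> ss; have [Q [c [v [po _ pb]]]] := A4 ax ss (@to_one_epi S).
have i1 : iso_off_one_point one (to_one one S) by move=> j k _ _; apply: to_one_eq.
have [ec ic] := A5 ax ss (@to_one_epi S) i1 po.
exists Q, c, v; split=> // j jv; apply: contrapT => nj.
have [cv|ncv] := pselect (pullback_at_point_iso c v).
  apply: nj; apply: iso_trivial_fibre; apply: pushout_of_iso po _.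
  have [P [p [q [pb' qi]]]] := cv.
  have [h [hi _ Eh]] := pullback_unique pb pb'.
  apply: is_identity_iso; apply: epi_strong_mono_identity; first exact: to_one_epi.
  by rewrite -Eh; apply: strong_mono_comp; apply: iso_strong_mono.
by apply: jv; apply: ic => // /trivial_fibreP.
Qed.

(** The image of [h] is all of [Y] by [strong_mono_onto], unless [B] is terminal. Over points away
    from [v] the fibres of [h] are trivial because those of [x] are; over [v], [h] matches the two
    copies of [D]. *)
Lemma graft_hom_identity D B X Y (v : Hom one B) (x : Hom X B) (y : Hom Y B)
    (m : Hom D X) (n : Hom D Y) (h : Hom X Y) :
  epi x -> is_pullback x v m (to_one one D) -> is_pullback y v n (to_one one D) ->
  (forall j, j <> v -> trivial_fibre x j) ->
  h ∘ m = n -> y ∘ h = x -> is_identity h.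
Proof.
move=> ex pbx pby xj hm yh.
have eh : epi h.
  have [Z [g [s [eg ss Eh]]]] := A2 ax h.
  have eys : epi (y ∘ s).
    by apply: (@epi_cancel _ _ _ _ _ g); rewrite -comp_assoc -Eh yh.
  have [B1|si] := strong_mono_onto ss eys; last first.
    by rewrite Eh; apply: epi_comp => //; apply: is_identity_epi.
  (* Here [B] is terminal, so [n], a pullback of a point of [B], has a right inverse. *)
  apply: (@epi_cancel _ _ _ _ _ m); rewrite hm.
  have [k [nk _]] : exists k : Hom Y D, n ∘ k = idm Y /\ to_one one D ∘ k = to_one
    one Y.
    by apply: (pullback_factor pby); move: (y ∘ _) (v ∘ _); rewrite B1 => a b;
      apply: to_one_eq.
  by apply: (@epi_cancel _ _ _ _ _ k); rewrite nk; apply: is_identity_epi.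
apply: trivial_fibres_identity => // k.
have [ykv|ykv] := pselect (y ∘ k = v); last first.
  by apply: (trivial_fibre_cancel (z := y)) => //; rewrite yh; apply: xj.
have [|k' [nk _]] := pullback_factor pby (x := k) (y := idm one).
  by rewrite comp_idr.
exists (m ∘ k') => [|W w hw]; first by rewrite comp_assoc hm.
have [|w' [mw _]] := pullback_factor pbx (x := w) (y := to_one one W).
  by rewrite -yh -comp_assoc hw comp_assoc ykv.
have Ew : w' = k' ∘ to_one one W.
  by apply: (pullback_mono pby (proj1 (point_strong_mono v)));
    rewrite comp_assoc nk -hw -hm -mw comp_assoc.
by rewrite -mw Ew comp_assoc.
Qed.

(* Otherwise collapsing the fibre of [d] over [j] would give another object of
   F(A, v), and the composite of the collapse with the map back to [X] would be
   the identity. *)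
Lemma terminal_graft_fibres A B X (v : Hom one B) (d : Hom X B) (u : Hom A X) :
  epi d -> is_pullback d v u (to_one one A) ->
  (forall X' (d' : Hom X' B) (u' : Hom A X'), epi d' ->
     is_pullback d' v u' (to_one one A) ->
     exists! h : Hom X' X, h ∘ u' = u /\ d ∘ h = d') ->
  forall j, j <> v -> trivial_fibre d j.
Proof.
move=> ed pb U j jv; have [F [f [sf pbf]]] := point_fibre j ed.
have [Q [g [k [eg po pbg gk]]]] := collapse sf.
have [w [wg wk]] := pushout_factor po (proj1 pbf).
have ew : epi w by apply: (@epi_cancel _ _ _ _ _ g); rewrite wg.
have mv := proj1 (point_strong_mono v).
have [G [n [sn pbn]]] := point_fibre v ew.
have [|a [na _]] := pullback_factor pbn (x := g ∘ u) (y := to_one one A).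
  by rewrite comp_assoc wg (proj1 pb).
have pba : is_pullback g n u a.
  apply: (pullback_cancel (f := w) (g := v) (q :=
    to_one one G)) (proj1 sn) _ (proj1 pbn) (esym na).
  by rewrite wg (to_one_eq (to_one one G ∘ a) (to_one one A)).
(* The collapse [g] only affects points over [j], so the fibre over [v] remains [A]. *)
have ia : is_iso a.
  apply: is_identity_iso; apply: trivial_fibres_identity.
    exact: epi_pullback eg sn pba.
  move=> x; apply: (trivial_fibre_pullback (proj1 sn) pba); apply: gk => nx.
  apply: jv; rewrite -wk -nx comp_assoc (proj1 pbn) -comp_assoc.
  by rewrite -[RHS]comp_idr; congr (_ ∘ _); apply: to_one_eq.
have pbQ : is_pullback w v (g ∘ u) (to_one one A).
  rewrite -na (to_one_eq (to_one one A) (to_one one G ∘ a)).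
  exact: pullback_iso.
have [l [[lgu dl] _]] := U _ _ _ ew pbQ.
have lg : l ∘ g = idm X.
  have [i [_ iU]] := U _ _ _ ed pb.
  rewrite -(iU (l ∘ g)); first by apply: iU; rewrite comp_idl comp_idr.
  by rewrite -comp_assoc lgu comp_assoc dl wg.
have /is_identity_iso gi := epi_strong_mono_identity eg (split_strong_mono lg).
have [p gp gU] := iso_trivial_fibre k gi.
exists p => [|W x /(pullback_factor pbf)[y [<- _]]];
  first by rewrite -wg -comp_assoc gp.
apply: gU; rewrite comp_assoc (proj1 pbg) -comp_assoc.
by congr (_ ∘ _); apply: to_one_eq.
Qed.

(** The map from [X] to the terminal object given by (A6) is an identity by [graft_hom_identity], so
    [X] inherits the universal property. *)
Lemma graft_terminal D B X (v : Hom one B) (x : Hom X B) (m : Hom D X) :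
  epi x -> is_pullback x v m (to_one one D) ->
  (forall j, j <> v -> trivial_fibre x j) ->
  forall Y (y : Hom Y B) (n : Hom D Y), epi y ->
    is_pullback y v n (to_one one D) -> exists! h : Hom Y X, h ∘ n = m /\ x ∘ h = y.
Proof.
move=> ex pbx xj Y y n ey pby.
have [K [d [u [_ ed pbd U]]]] := terminal_graft D v.
have [g [[gm dg] _]] := U _ _ _ ex pbx.
have /is_identity_iso[g' [g'g gg']] := graft_hom_identity ex pbx pbd xj gm dg.
have [h [[hn dh] hU]] := U _ _ _ ey pby.
exists (g' ∘ h); split.
  split; first by rewrite -comp_assoc hn -gm comp_assoc g'g comp_idl.
  by rewrite -dg -comp_assoc (comp_assoc g) gg' comp_idl.
move=> k [kn xk]; rewrite (hU (g ∘ k)) ?comp_assoc ?g'g ?comp_idl //.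
by rewrite -comp_assoc kn gm dg.
Qed.

(* With [v : 1 -> B/D] the collapse of [m], the terminal object of F(A, v) is
   also terminal in F(e, m): its pushout along [e] is a terminal object of
   F(D, v), as is [B]. *)
Lemma graft_exists A D B (e : Hom A D) (m : Hom D B) : epi e -> strong_mono m ->
  exists K (c : Hom K B) (u : Hom A K),
    [/\ epi c, is_pullback c m u e, is_pushout u e c m,
        forall K' (c' : Hom K' B) (u' : Hom A K'), epi c' ->
          is_pullback c' m u' e -> exists! h : Hom K' K, h ∘ u' = u /\ c ∘ h = c' &
        forall j, (forall j', j <> m ∘ j') -> trivial_fibre c j].
Proof.
move=> ee sm; have [B' [b [v [eb pob pbb bj]]]] := collapse sm.
have mv := proj1 (point_strong_mono v).
have BU := graft_terminal eb pbb bj.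
have [K [d [u [su ed pbd U]]]] := terminal_graft A v.
have dj := terminal_graft_fibres ed pbd U.
(* The pushout of an object of F(A, v) along [e] is an object of F(D, v). *)
have push X (x : Hom X B') (n : Hom A X) : epi x -> is_pullback x v n (to_one one A) ->
    exists Y (g : Hom X Y) (k : Hom D Y) (y : Hom Y B'),
      [/\ is_pushout n e g k, y ∘ g = x, epi y & is_pullback y v k (to_one one D)].
  move=> ex pbx; have sn := pullback_strong_mono pbx (point_strong_mono v).
  have [Y [g [k [po sk pbk]]]] := A4 ax sn ee.
  have [|y [yg yk]] := pushout_factor po (x := x) (y := v ∘ to_one one D).
    by rewrite (proj1 pbx) -comp_assoc; congr (_ ∘ _); apply: to_one_eq.
  have ey : epi y by apply: (@epi_cancel _ _ _ _ _ g); rewrite yg.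
  exists Y, g, k, y; split=> //.
  have [F [f [sf pbf]]] := point_fibre v ey.
  have [l [fl _]] := pullback_factor pbf yk.
  have pbl : is_pullback g f n (l ∘ e).
    apply: (pullback_cancel (f := y) (g := v) (q :=
      to_one one F)) (proj1 sf) _ (proj1 pbf) _.
      by rewrite yg (to_one_eq (to_one one F ∘ (l ∘ e)) (to_one one A)).
    by rewrite comp_assoc fl (proj1 po).
  (* The fibre of [y] over [v] is exactly [D]: [l] is strong because [f ∘ l = k] is, and epi because
     [l ∘ e] is a pullback of the epimorphism [g]. *)
  have il : is_iso l.
    apply: epi_strong_mono_iso; last by apply: (@strong_mono_cancel _ _ _ _ f);
      rewrite fl.
    apply: (@epi_cancel _ _ _ _ _ e); apply: epi_pullback sf pbl.
    exact: pushout_epi po ee.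
  by rewrite -fl (to_one_eq (to_one one D) (to_one one F ∘ l)); apply: pullback_iso.
have [Y [c1 [k [w [po wc1 ew pbw]]]]] := push _ _ _ ed pbd.
have ec1 := pushout_epi po ee.
have wj j : j <> v -> trivial_fibre w j.
  by move=> jv; apply: (trivial_fibre_epi ec1 ew); rewrite wc1; apply: dj.
have [h [[hk bh] _]] := BU _ _ _ ew pbw.
have hi := is_identity_iso (graft_hom_identity ew pbw pbb wj hk bh).
have bc : b ∘ (h ∘ c1) = d by rewrite comp_assoc bh.
have poc : is_pushout u e (h ∘ c1) m by rewrite -hk; apply: pushout_iso.
have ec : epi (h ∘ c1) by apply: epi_comp => //; apply: iso_epi.
have pbc : is_pullback (h ∘ c1) m u e.
  apply: (pullback_cancel (f := b) (g := v) (q :=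
    to_one one D)) (proj1 sm) _ (proj1 pbb) (proj1 poc).
  by rewrite bc (to_one_eq (to_one one D ∘ e) (to_one one A)).
exists K, (h ∘ c1), u; split=> // [K' c' u' ec' pbc'|j jm]; last first.
  apply: (trivial_fibre_cancel (z := b)) => //; rewrite bc; apply: dj => bjv.
  have [|j' [mj _]] := pullback_factor pbb (x := j) (y := idm one);
    first by rewrite comp_idr.
  exact: jm (esym mj).
have ebc : epi (b ∘ c') by apply: epi_comp.
have pbK' : is_pullback (b ∘ c') v u' (to_one one A).
  by rewrite (to_one_eq (to_one one A) (to_one one D ∘ e));
    apply: pullback_paste pbb pbc'.
have [l [[lu dl] lU]] := U _ _ _ ebc pbK'.
have [Y' [g [k' [y [po' yg ey pby]]]]] := push _ _ _ ebc pbK'.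
exists l; split=> [|l' [lu' cl']]; last first.
  by apply: lU; rewrite -bc -comp_assoc cl'.
(* To get [c ∘ l = c'], extend both sides to the pushout [Y'] of [K'] along [e]. The extensions [s]
   and [t] are morphisms to [B] in F(D, v), hence equal. *)
split=> //; have [i [_ iU]] := BU _ _ _ ey pby.
have [s [sg sk]] : exists s : Hom Y' B, s ∘ g = (h ∘ c1) ∘ l /\ s ∘ k' = m.
  by apply: (pushout_factor po'); rewrite -comp_assoc lu (proj1 poc).
have [t [tg tk]] : exists t : Hom Y' B, t ∘ g = c' /\ t ∘ k' = m.
  by apply: (pushout_factor po'); rewrite (proj1 pbc').
have eg := pushout_epi po' ee.
rewrite -sg -tg -(iU s); last by split=> //; apply: eg;
  rewrite -comp_assoc sg comp_assoc bc yg.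
by rewrite (iU t) //; split=> //; apply: eg; rewrite -comp_assoc tg yg.
Qed.

(** * Components and normal forms *)

Lemma comp_identity X Y Z (g : Hom Y Z) (f : Hom X Y) :
  is_identity (g ∘ f) -> strong_mono g -> is_identity g.
Proof.
move=> i sg; apply: epi_strong_mono_identity => //.
by apply: (@epi_cancel _ _ _ _ _ f); apply: is_identity_epi.
Qed.

(** Composition with [s] embeds the strong monomorphisms into [A] in those into [X] and misses the
    identity of [X]; these sets are finite by (A7). *)
Lemma strong_mono_wf :
  well_founded (fun A X => exists2 s : Hom A X, strong_mono s & ~ is_identity s).
Proof.
apply: (wf_finite_inj (P := fun X => [set f : {A :
  C & Hom A X} | strong_mono (projT2 f)]%classic)).
  exact: (A7_strong_mono ax).
move=> A X [s ss ns]; exists (fun f => existT _ (projT1 f) (s ∘ projT2 f)); split.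
- by move=> [Y f] /= sf; apply: strong_mono_comp.
- move=> [Y f] [Y' f'] /= _ _ E; have EY := congr1 (@projT1 _ _) E; rewrite /= in EY.
  by subst Y'; rewrite (proj1 ss _ _ _ (existT_inj E)).
exists (existT (Hom^~ X) X (idm X)) => [|[Y f] /= sf E].
  exact: iso_strong_mono (is_identity_iso (IsIdentity X)).
have EY := congr1 (@projT1 _ _) E; rewrite /= in EY; subst Y.
by apply/ns/(@comp_identity _ _ _ _ f) => //; rewrite (existT_inj E).
Qed.

Lemma epi_wf :
  well_founded (fun Y X => exists2 d : Hom X Y, epi d & ~ is_identity d).
Proof.
apply: (wf_finite_inj (P := fun X => [set f : {Y :
  C & Hom X Y} | epi (projT2 f)]%classic)).
  exact: (A7_epi ax).
move=> Y X [d ed nd]; exists (fun f => existT _ (projT1 f) (projT2 f ∘ d)); split.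
- by move=> [Z f] /= ef; apply: epi_comp.
- move=> [Z f] [Z' f'] /= _ _ E; have EZ := congr1 (@projT1 _ _) E; rewrite /= in EZ.
  by subst Z'; rewrite (ed _ _ _ (existT_inj E)).
exists (existT _ X (idm X)) => [|[Z f] /= ef E].
  exact: is_identity_epi.
have EZ := congr1 (@projT1 _ _) E; rewrite /= in EZ; subst Z.
by apply/nd/epi_strong_mono_identity => //; apply: split_strong_mono (existT_inj E).
Qed.

(** Components are pairwise incomparable: [arr k] is no identity, so indecomposability of [arr i]
    makes [g] one. *)
Lemma component_le X (i k : component X) (g : Hom (dom i) (dom k)) :
  arr i = arr k ∘ g -> i = k.
Proof.
case: i k g => [A f fP] [B h hP] /= g E.
have [sf _ fI] := fP; have [sh nh _] := hP.
have sg : strong_mono g by apply: (@strong_mono_cancel _ _ _ _ h); rewrite -E.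
have [gi|//] := fI _ _ _ sg sh E.
destruct gi; rewrite comp_idr in E; subst h.
by rewrite (Prop_irrelevance fP hP).
Qed.

Lemma component_common X (i k : component X) W (x : Hom W (dom i)) (y : Hom W (dom k)) :
  strong_mono x -> strong_mono y -> arr i ∘ x = arr k ∘ y -> i = k.
Proof.
have [si _ _] := arrP i; have [sk _ _] := arrP k.
move=> sx sy /(A8 ax sx sy si sk)[[h [_ /esym/component_le]]|[h [_
  /esym/component_le]]] //.
Qed.

(** Climb from [s] to larger proper strong subobjects until one is indecomposable. The climb ends
    because the finite set of strong monomorphisms through which [g] factors loses [g] at each
    step. *)
Lemma component_factor A X (s : Hom A X) : strong_mono s -> ~ is_identity s ->
  exists (i : component X) (t : Hom A (dom i)), strong_mono t /\ s = arr i ∘ t.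
Proof.
pose S := {f : {Y : C & Hom Y X} | strong_mono (projT2 f)}.
pose above (f g : S) := exists2 u, projT2 (sval g) = projT2 (sval f) ∘ u & ~
  is_identity u.
have wf : well_founded above.
  apply: (wf_finite_inj (F := fun=> {Y : C & Hom Y X}) (P := fun g : S => [set f :
    {Y : C & Hom Y X} |
    strong_mono (projT2 f) /\ exists u, projT2 (sval g) = projT2 f ∘ u]%classic)).
    by move=> g; apply: sub_finite_set (A7_strong_mono ax X) => f [].
  move=> f g [u Eu nu]; exists id; split=> //.
    by move=> k [sk [w Ew]]; split=> //; exists (w ∘ u); rewrite Eu Ew comp_assoc.
  exists (sval g) => [|x [_ [w Ew]] /= E].
    by split; [exact: (svalP g) | exists (idm _); rewrite comp_idr].
  subst x; apply: nu; apply: epi_strong_mono_identity.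
    apply: (@epi_cancel _ _ _ _ _ w); apply: is_identity_epi.
    suff -> : u ∘ w = idm _ by [].
    by apply: (proj1 (svalP f)); rewrite comp_assoc -Eu -Ew comp_idr.
  by apply: (@strong_mono_cancel _ _ _ _ (projT2 (sval f))); rewrite -Eu;
    apply: (svalP g).
suff main (g : S) : ~ is_identity (projT2 (sval g)) -> exists (i : component X) t,
    strong_mono t /\ projT2 (sval g) = arr i ∘ t.
  by move=> ss; apply: (main (exist _ (existT (Hom^~ X) A s) ss)).
elim/(well_founded_ind wf): g => -[[B g] /= sg] IH ng.
have [ig|] := pselect (indecomposable g).
  exists (Component ig), (idm B); rewrite comp_idr; split=> //.
  exact: iso_strong_mono (is_identity_iso (IsIdentity B)).
move=> dec; suff [Y [u [v [su sv [E nu nv]]]]] : exists Y (u : Hom B Y) (v : Hom Y X),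
    [/\ strong_mono u, strong_mono v & [/\ g = v ∘ u, ~ is_identity u & ~
      is_identity v]].
  have [|//|i [t [st Et]]] := IH (exist _ (existT (Hom^~ X) Y v) sv); first by exists u.
  exists i, (t ∘ u); split; first exact: strong_mono_comp.
  by rewrite comp_assoc -Et.
apply: contrapT => H; apply: dec; split=> // Y u v su sv E;
  apply: contrapT => /not_orP[nu nv].
by apply: H; exists Y, u, v.
Qed.

Lemma component_max X (k : component X) Y (u : Hom (dom k) Y) (v : Hom Y X) :
  strong_mono v -> ~ is_identity v -> arr k = v ∘ u -> is_identity u.
Proof.
move=> sv nv E; have [sk _ kI] := arrP k.
have su : strong_mono u by apply: (@strong_mono_cancel _ _ _ _ v); rewrite -E.
by have [] := kI _ _ _ su sv E.
Qed.

(** * Components along an epimorphism with codomain other than 1 *)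

Section Components.
Variables (X N : C) (c : Hom X N).
Hypotheses (ec : epi c) (N1 : N <> one).

Lemma component_image (i : component X) : exists B (e : Hom (dom i) B) (s : Hom B N),
  [/\ epi e, strong_mono s, ~ is_identity s & c ∘ arr i = s ∘ e].
Proof.
have [si ni _] := arrP i; have [B [e [s [ee ss E]]]] := A2 ax (c ∘ arr i).
exists B, e, s; split=> // /is_identity_epi es.
have [] // := strong_mono_onto si (d := c).
by rewrite E; apply: epi_comp.
Qed.

(** The pullback [p] of [arr k] lies in some component [i], whose image in [N] is proper and
    contains [arr k]. By maximality the image is [arr k], so [i] lies in [p] as well. *)
Lemma component_pullback (k : component N) :
  exists (i : component X) (e : Hom (dom i) (dom k)),
    epi e /\ is_pullback c (arr k) (arr i) e.
Proof.
have [sk nk _] := arrP k; have [P [p [q [pb eq]]]] := A3 ax ec sk.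
have sp := pullback_strong_mono pb sk.
have np : ~ is_identity p.
  move=> /is_identity_epi ep; apply/nk/epi_strong_mono_identity => //.
  by apply: (@epi_cancel _ _ _ _ _ q); rewrite -(proj1 pb); apply: epi_comp.
have [i [t [st Ep]]] := component_factor sp np.
have [Z [e [s [ee ss ns Es]]]] := component_image i; have [si _ _] := arrP i.
have [l [lq ls]] : exists l : Hom (dom k) Z, l ∘ q = e ∘ t /\ s ∘ l = arr k.
  by apply: (proj2 ss) => //; rewrite comp_assoc -Es -comp_assoc -Ep (proj1 pb).
have /is_identity_iso[l' [l'l ll']] := component_max ss ns (esym ls).
have [|h [ph qh]] := pullback_factor pb (x := arr i) (y := l' ∘ e).
  by rewrite Es -ls -!comp_assoc (comp_assoc l) ll' comp_idl.
have pt : is_iso t.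
  exists h; split; last first.
    by apply: (proj1 si); rewrite comp_assoc -Ep ph comp_idr.
  by apply: (proj1 sp); rewrite comp_assoc ph -Ep comp_idr.
have hi : is_iso h.
  case: pt => t' [t't tt'].
  have Et : t' = h by apply: (proj1 sp); rewrite ph Ep -comp_assoc tt' comp_idr.
  by rewrite -Et; exists t.
exists i, (q ∘ h); split; first by apply: epi_comp => //; apply: iso_epi.
by rewrite -ph; apply: pullback_iso.
Qed.

Lemma corresponds_pullback (k : component N) (i : component X) : corresponds c i k ->
  exists e, epi e /\ is_pullback c (arr k) (arr i) e.
Proof.
case=> e [ee E]; have [i' [e' [ee' pb]]] := component_pullback k.
have [h [/esym/component_le Ei _]] := pullback_factor pb E.
by rewrite Ei; exists e'.
Qed.

Lemma corresponds_inj (k : component N) (i i' : component X) :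
  corresponds c i k -> corresponds c i' k -> i = i'.
Proof.
move=> [e [_ E]] /corresponds_pullback[e' [_ pb]].
by have [h [/esym/component_le]] := pullback_factor pb E.
Qed.

Lemma corresponds_fun (k k' : component N) (i : component X) :
  corresponds c i k -> corresponds c i k' -> k = k'.
Proof.
move=> [e [ee E]] [e' [ee' E']]; have [[_ sk'] _ _] := arrP k'.
have [|l [_ /esym/component_le //]] := sk' _ _ e e' (arr k) ee.
by rewrite -E.
Qed.

(** The image of [i] lies in a component [k]; the preimage of [k] is a component containing [i],
    hence is [i]. *)
Lemma corresponds_exists (i : component X) : exists k, corresponds c i k.
Proof.
have [Z [e [s [ee ss ns Es]]]] := component_image i.
have [k [t [st Et]]] := component_factor ss ns.
have [i' [e' [ee' pb]]] := component_pullback k.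
have [|h [/esym/component_le Ei _]] := pullback_factor pb (x := arr i) (y := t ∘ e).
  by rewrite Es Et -comp_assoc.
by exists k; rewrite Ei; exists e'; split=> //; case: pb.
Qed.

End Components.

Lemma corresponds_comp X Y Z (c : Hom X Y) (d : Hom Y Z) (i : component X)
    (k : component Y) (l : component Z) :
  corresponds c i k -> corresponds d k l -> corresponds (d ∘ c) i l.
Proof.
move=> [e [ee E]] [e' [ee' E']]; exists (e' ∘ e); split; first exact: epi_comp.
by rewrite -comp_assoc E !comp_assoc E'.
Qed.

(** * Existence and uniqueness of normal forms *)

Lemma in_Eo_epi X Y (f : Hom X Y) : in_Eo one f -> epi f.
Proof. by case=> [[]|[/is_identity_epi]]. Qed.

Lemma in_EoI X Y (f : Hom X Y) : epi f -> Y <> one -> in_Eo one f.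
Proof. by left. Qed.

Lemma source_neq1 X Y (f : Hom X Y) : epi f -> Y <> one -> X <> one.
Proof. move=> ef nY X1; apply: nY; subst X; exact: point_epi ef. Qed.

Lemma normalize X : X <> one ->
  exists (phi : label one) (rho : Hom X phi), in_Eo one rho.
Proof.
elim/(well_founded_ind epi_wf): X => X IH nX.
have [nX'|] := pselect (normal one X).
  by exists (Label nX' nX), (idm X); apply: in_EoI => //; apply: is_identity_epi.
move=> nn; have [Y [d [ed nY nd]]] : exists Y (d :
  Hom X Y), [/\ epi d, Y <> one & ~ is_identity d].
  apply: contrapT => H; apply: nn => Y d [[ed nY]|[//]].
  by apply: contrapT => nd; apply: H; exists Y, d.
have [|phi [rho rE]] := IH Y _ nY; first by exists d.
exists phi, (rho ∘ d); apply: in_EoI (@lab_neq1 _ _ phi).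
by apply: epi_comp => //; apply: in_Eo_epi.
Qed.

(* A proper epimorphism [f] factors through the collapse of one of its fibres
   [S]; as [N] is normal, so does [g]: the collapse of the image of [S] in [N]
   does not end in the terminal object, hence is an identity. *)
Lemma normal_factor X Y N (f : Hom X Y) (g : Hom X N) :
  epi f -> Y <> one -> epi g -> N <> one -> normal one N ->
  exists h : Hom Y N, h ∘ f = g.
Proof.
elim/(well_founded_ind epi_wf): X f g => X IH f g ef nY eg nN norm.
have [/is_identity_iso[f' [f'f _]]|nf] := pselect (is_identity f).
  by exists (g ∘ f'); rewrite -comp_assoc f'f comp_idr.
have [j nj] : exists j, ~ trivial_fibre f j.
  apply: contrapT => H; apply/nf/trivial_fibres_identity => // j.
  by apply: contrapT => nj; apply: H; exists j.
have [S [s [ss pb]]] := point_fibre j ef.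
have [Q [c [v [ec po pbc _]]]] := collapse ss.
have [w [wc wv]] := pushout_factor po (proj1 pb).
have ew : epi w by apply: (@epi_cancel _ _ _ _ _ c); rewrite wc.
have nc : ~ is_identity c.
  move=> /is_identity_iso/(iso_trivial_fibre v)[p cp cU]; apply: nj.
  exists p => [|W x /(pullback_factor pb)[y [<- _]]];
    first by rewrite -wc -comp_assoc cp.
  apply: cU; rewrite comp_assoc (proj1 pbc) -comp_assoc.
  by congr (_ ∘ _); apply: to_one_eq.
have [Z [e [t [ee st Et]]]] := A2 ax (g ∘ s).
have [R [d [r [ed pod pbd _]]]] := collapse st.
(* Otherwise [g ∘ s] is epi, so [s] is an identity and [f] factors through [j], against
   [Y <> one]. *)
have nt : ~ is_identity t.
  move=> /is_identity_epi et; have [|//|/is_identity_epi es] :=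
    strong_mono_onto ss (d := g).
    by rewrite Et; apply: epi_comp.
  apply: nY; apply: (point_epi (j := j)); apply: (@epi_cancel _ _ _ _ _ (to_one one S)).
  by rewrite -(proj1 pb); apply: epi_comp.
have nR : R <> one.
  move=> R1; apply: nt; apply: iso_identity.
  have [k [tk _]] : exists k : Hom N Z, t ∘ k = idm N /\ to_one one Z ∘ k = to_one
    one N.
    by apply: (pullback_factor pbd); move: (d ∘ _) (r ∘ _); rewrite R1 => a b;
      apply: to_one_eq.
  exists k; split=> //; apply: (proj1 st).
  by rewrite comp_assoc tk comp_idl comp_idr.
have /is_identity_iso[d' [d'd _]] := norm _ _ (in_EoI ed nR).
have [|h [hc _]] := pushout_factor po (x := d ∘ g) (y := r).
  rewrite -comp_assoc Et comp_assoc (proj1 pod) -comp_assoc.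
  by congr (_ ∘ _); apply: to_one_eq.
have Eg : (d' ∘ h) ∘ c = g by rewrite -comp_assoc hc comp_assoc d'd comp_idl.
(* Both [f] and [g] factor through the proper quotient [Q], to which the induction applies. *)
have [||l lw] := IH Q _ w (d' ∘ h) ew nY _ nN norm.
- by exists c.
- by apply: (@epi_cancel _ _ _ _ _ c); rewrite Eg.
by exists l; rewrite -wc comp_assoc lw.
Qed.

(** Normality makes the comparison map [h] an identity. The Leibniz form avoids an equation between
    arrows with different codomains. *)
Lemma normalization_unique X (phi psi : label one) (rho : Hom X phi) (sigma : Hom X psi)
    (Q : forall psi : label one, Hom X psi -> Prop) :
  in_Eo one rho -> in_Eo one sigma -> Q phi rho -> Q psi sigma.
Proof.
case: phi rho => [N nN N1] /= rho; case: psi sigma => [M nM M1] /= sigma rE sE.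
have [h hr] := normal_factor (in_Eo_epi rE) N1 (in_Eo_epi sE) M1 nM.
have ih : is_identity h.
  apply: nN; apply: in_EoI => //; apply: (@epi_cancel _ _ _ _ _ rho).
  by rewrite hr; apply: in_Eo_epi sE.
subst sigma; destruct ih; rewrite comp_idl.
by rewrite (Prop_irrelevance nM nN) (Prop_irrelevance M1 N1).
Qed.

(** * Trees *)

Lemma component_neq1 X (i : component X) : X <> one.
Proof.
move=> X1; have [si ni _] := arrP i; apply: ni; apply: epi_strong_mono_identity => //.
case: i {si} => A f /= _; subst X; rewrite (to_one_unique f); exact: to_one_epi.
Qed.

Section TreeMap.
Variable num : numbering one.

(** A relational tree map, recursive in the tree: existence goes by induction on objects, uniqueness
    by induction on trees. *)
Fixpoint represents (t : tree (ar num)) (X : C) : Prop :=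
  match t with
  | leaf => X = one
  | node phi ch => X <> one /\ exists rho : Hom X phi, in_Eo one rho /\
      forall p, exists i : component X,
        corresponds rho i (input p) /\ represents (ch p) (dom i)
  end.

Lemma represents_exists X : exists t, represents t X.
Proof.
elim/(well_founded_ind strong_mono_wf): X => X IH.
have [X1|nX] := pselect (X = one); first by exists leaf.
have [phi [rho rE]] := normalize nX.
suff /choice[ch chP] : forall p, exists t, exists i : component X,
    corresponds rho i (@input _ _ num phi p) /\ represents t (dom i).
  by exists (node ch); split=> //; exists rho.
move=> p; have [i [e [ee [E _]]]] :=
  component_pullback (in_Eo_epi rE) (@lab_neq1 _ _ phi) (input p).
have [si ni _] := arrP i.
have [|t ti] := IH (dom i); first by exists (arr i).
by exists t, i; split=> //; exists e.
Qed.

Lemma represents_fun t t' X : represents t X -> represents t' X -> t = t'.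
Proof.
elim: t t' X => [|phi ch IH] [|psi ch'] X //=; [by move=> X1 []|by case|].
move=> [nX [rho [rE chP]]] [_ [sigma [sE chP']]].
(* The children are quantified inside [Q] because their index type depends on the label being
   replaced. *)
pose Q (psi : label one) (sigma : Hom X psi) := forall ch' :
  'I_(ar num psi) -> tree (ar num),
  (forall p, exists i : component X,
        corresponds sigma i (input p) /\ represents (ch' p) (dom i)) ->
  node ch = node ch'.
apply: (normalization_unique (Q := Q) rE sE) chP' => {sE sigma} {}ch' chP'.
congr node; apply: funext => p.
have [i [ri ti]] := chP p; have [i' [ri' ti']] := chP' p.
apply: IH ti _.
by rewrite (corresponds_inj (in_Eo_epi rE) (@lab_neq1 _ _ phi) ri ri').
Qed.

Lemma tree_map_represents (T : C -> tree (ar num)) X : tree_map T -> represents (T X) X.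
Proof.
move=> [T1 TX]; elim/(well_founded_ind strong_mono_wf): X => X IH.
have [->|nX] := pselect (X = one); first by rewrite T1.
have [phi [rho [ch [rE -> chP]]]] := TX _ nX.
split=> //; exists rho; split=> // p; have [i [ri ->]] := chP p.
have [si ni _] := arrP i.
by exists i; split=> //; apply: IH; exists (arr i).
Qed.

Lemma tree_map_exists_unique : exists! T : C -> tree (ar num), tree_map T.
Proof.
have [T TX] := choice represents_exists; exists T; split; last first.
  move=> T' mT'; apply: funext => X.
  exact: represents_fun (TX X) (tree_map_represents X mT').
split; first exact: (@represents_fun _ leaf one (TX one)).
move=> X nX; have := TX X; case E: (T X) => [|phi ch] //= [_ [rho [rE chP]]].
exists phi, rho, ch; split=> // p; have [i [ri ti]] := chP p.
by exists i; split=> //; apply: represents_fun ti (TX _).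
Qed.

Lemma tree_map_node (T : C -> tree (ar num)) X (phi : label one) (rho : Hom X phi) :
  tree_map T -> in_Eo one rho ->
  exists ch : 'I_(ar num phi) -> tree (ar num), T X = node ch /\
    forall p i, corresponds rho i (input p) -> ch p = T (dom i).
Proof.
move=> [_ TX] rE.
have nX : X <> one by apply: source_neq1 (in_Eo_epi rE) (@lab_neq1 _ _ phi).
have [psi [sigma [ch [sE E chP]]]] := TX _ nX.
apply: (normalization_unique (Q := fun (phi : label one) (rho : Hom X phi) =>
  exists ch : 'I_(ar num phi) -> tree (ar num), T X = node ch /\
    forall p i, corresponds rho i (input p) -> ch p = T (dom i)) sE rE).
exists ch; split=> // p i ri; have [i' [ri' ->]] := chP p.
by rewrite (corresponds_inj (in_Eo_epi sE) (@lab_neq1 _ _ psi) ri ri').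
Qed.

(* The fibres of [c] outside [m] being points, [c] restricts to an isomorphism on
   each component of [B] except the one containing [m]. *)
Lemma tree_map_graft (T : C -> tree (ar num)) A D B K (e : Hom A D) (m : Hom D B)
    (c : Hom K B) (u : Hom A K) :
  tree_map T -> strong_mono m -> epi c -> is_pullback c m u e ->
  (forall j, (forall j', j <> m ∘ j') -> trivial_fibre c j) ->
  exists a, [/\ input_path num m a, is_pos (T B) a, subtree (T B) a = T D &
                T K = replace_at (T B) a (T A)].
Proof.
move=> mT; elim/(well_founded_ind strong_mono_wf): B => B IH in K m c u *.
move=> sm ec pb cj.
have [im|nm] := pselect (is_identity m).
  destruct im; exists [::]; split=> //; first exact: PathId.
  have [h [hi _ _]] := pullback_unique pb (pullback_id c).
  by rewrite (is_identity_ob (iso_identity hi)).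
have [i [t [st Em]]] := component_factor sm nm.
have nB := component_neq1 i; have [si ni _] := arrP i.
have [phi [rho rE]] := normalize nB; have nphi := @lab_neq1 _ _ phi.
have er := in_Eo_epi rE.
have [k rk] := corresponds_exists er nphi i.
have [p ri] : exists p, corresponds rho i (@input _ _ num phi p).
  by case: (input_bij num phi) => g _ gK; exists (g k); rewrite gK.
have [i' [e' [ee' pbi]]] := component_pullback ec nB i.
have [si' _ _] := arrP i'.
have [y [Ey ey]] : exists y, arr i' ∘ y = u /\ e' ∘ y = t ∘ e.
  by apply: (pullback_factor pbi); rewrite (proj1 pb) Em comp_assoc.
have su := pullback_strong_mono pb sm.
(* Induction applies to the restriction [e'] of [c] over the component [i] that contains [m]. *)
have [|//|//||j jt|a [pa posa sa ra]] := IH (dom i) _ _ t e' y.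
- by exists (arr i).
- apply: pullback_monoI (proj1 st) _ ey _.
    by apply: proj1; apply: (@strong_mono_cancel _ _ _ _ (arr i')); rewrite Ey.
  move=> W x z xz; have [|h [uh _]] := pullback_factor pb (x := arr i' ∘ x) (y := z).
    by rewrite comp_assoc (proj1 pbi) -comp_assoc xz Em comp_assoc.
  by exists h; apply: (proj1 si'); rewrite comp_assoc Ey.
- apply: (trivial_fibre_pullback (proj1 si) pbi); apply: cj => j'.
  by rewrite Em -comp_assoc => /(proj1 si); apply: jt.
have [ch [TB chP]] := tree_map_node mT rE.
(* Since [rho ∘ c] normalizes [K], the trees of [K] and [B] have the same root label. *)
have rcE : in_Eo one (rho ∘ c) by apply: in_EoI => //; apply: epi_comp.
have [ch' [TK chP']] := tree_map_node mT rcE.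
exists (val p :: a); rewrite TB TK /= valK (chP _ _ ri); split=> //.
  by rewrite Em; apply: PathStep rE ri pa.
congr node; apply: funext => q; case: eqP => [/val_inj ->|qp].
  rewrite (chP p i) // -ra; apply: chP'; apply: corresponds_comp ri.
  by exists e'; split=> //; case: pbi.
(* At any other input [q], a point of [l] lying in [m] would force [l = i]; so [g] has only trivial
   fibres and is an identity. *)
have [l [f [ef pbl]]] := component_pullback er nphi (input q).
have rl : corresponds rho l (input q) by exists f; split=> //; case: pbl.
have [l' [g [eg pbg]]] := component_pullback ec nB l.
have [sl _ _] := arrP l.
have cl : corresponds c l' l by exists g; split=> //; case: pbg.
rewrite (chP _ _ rl) (chP' _ _ (corresponds_comp cl rl)).
congr (T _); apply: (is_identity_ob (f := g)); apply: trivial_fibres_identity => // j.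
apply: (trivial_fibre_pullback (proj1 sl) pbg); apply: cj => j'.
rewrite Em -comp_assoc => E.
have Eli : l = i.
  by apply: (component_common (point_strong_mono j) _ E);
    apply: strong_mono_comp (point_strong_mono j').
apply: qp; congr (val _); apply: (bij_inj (input_bij num phi)).
by rewrite Eli in rl; apply: corresponds_fun rl ri.
Qed.

(** * Uniqueness of input paths *)

Lemma input_path_strong_mono A X (f : Hom A X) a : input_path num f a -> strong_mono f.
Proof.
elim=> {A X f a} [X|X A phi rho p i m a _ _ _ sm].
  exact: iso_strong_mono (is_identity_iso (IsIdentity X)).
by have [si _ _] := arrP i; apply: strong_mono_comp.
Qed.

Lemma input_path_inv A X (f : Hom A X) b : input_path num f b ->
  match b with
  | [::] => is_identity f
  | q :: b' => exists (phi : label one) (rho : Hom X phi) (p : 'I_(ar num phi))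
      (i : component X) (m : Hom A (dom i)),
      [/\ in_Eo one rho, corresponds rho i (input p), input_path num m b',
          f = arr i ∘ m & q = val p]
  end.
Proof.
case=> {A X f b} [X|X A phi rho p i m a rE ri pm]; first exact: IsIdentity.
by exists phi, rho, p, i, m.
Qed.

Lemma component_comp_proper A X (i : component X) (m : Hom A (dom i)) :
  ~ is_identity (arr i ∘ m).
Proof. by have [si ni _] := arrP i; move/comp_identity => /(_ si). Qed.

(** The arrow determines its last component by [component_common], the place of that component by
    uniqueness of normal forms, and the remaining arrow because components are monic. *)
Lemma input_path_fun A X (f : Hom A X) a b :
  input_path num f a -> input_path num f b -> a = b.
Proof.
move=> pa; elim: pa b => {A X f a} [X|X A phi rho p i m a rE ri pm IH] [|q b] //
  /input_path_inv.
- move=> [psi [sigma [q' [i [m [_ _ _ E _]]]]]].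
  by case: (@component_comp_proper _ _ i m); rewrite -E; apply: IsIdentity.
- by move/component_comp_proper.
move=> [psi [sigma [q' [i' [m' [sE ri' pm' E ->]]]]]].
have Ei := component_common (input_path_strong_mono pm) (input_path_strong_mono pm') E.
subst i'; have [si _ _] := arrP i.
rewrite -(proj1 si _ _ _ E) in pm'; rewrite (IH _ pm'); congr cons.
apply: (normalization_unique (Q := fun (psi : label one) (sigma :
  Hom X psi) => forall q : 'I_(ar num psi),
  corresponds sigma i (input q) -> val p = val q) rE sE) ri' => q'' ri''.
congr (val _); apply: (bij_inj (input_bij num phi)).
exact: corresponds_fun ri ri''.
Qed.

End TreeMap.

End NineAxioms.

(** * Transfer to an arbitrary terminal object and to the representation *)

Theorem theorem4p3 (C : category) (one : terminal_object C)
    (ax : nine_axioms one)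
    (A D B : C) (e : Hom A D) (m : Hom D B)
    (he : epi e) (hm : strong_mono m) :
  (exists t : F_cat e m, is_terminal t) /\
  (forall t : F_cat e m, is_terminal t ->
     let K := tr_ob (sval t) in
     let c : Hom K B := tr_down (sval t) in
     let u : Hom A K := tr_in (sval t) in
     is_pushout u e c m /\
     forall num : numbering one,
       (exists! T : C -> tree (ar num), tree_map T) /\
       (forall T : C -> tree (ar num), tree_map T ->
          exists a : seq nat,
            [/\ input_path num m a, is_pos (T B) a, subtree (T B) a = T D &
                T K = replace_at (T B) a (T A)]) /\
       (forall R : functor C (tree_category (ar num)), representation R ->
          R K = replace_at (R B) (th_addr (fmap R m)) (R A))).
Proof.
have [K [c [u [ec pb po U cj]]]] := graft_exists ax he hm.
pose t0 : F_cat e m := exist _ (@Triple C A B K c u) (conj ec pb).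
have t0T : is_terminal t0.
  move=> [[K' c' u'] [/= ec' pb']]; have [h [hh hU]] := U _ _ _ ec' pb'.
  by exists (exist _ h hh) => -[k kk]; apply: triple_hom_eq; apply: hU.
split=> [|[[K' c' u'] [ec' pb']] tT]; first by exists t0.
have [[h [/= hu' ch]] _] := t0T (exist _ (@Triple C A B K' c' u') (conj ec' pb')).
have [[k [/= ku ck]] _] := tT t0.
(* Terminal objects are isomorphic, hence equal here; eliminating [hi] turns the given one into
   [t0]. *)
have hi : is_identity h.
  apply: (iso_identity ax); exists k; split.
    have [g gU] := tT (exist _ (@Triple C A B K' c' u') (conj ec' pb')).
    have H1 : (k ∘ h) ∘ u' = u' /\ c' ∘ (k ∘ h) = c'.
      by rewrite -comp_assoc hu' ku comp_assoc ck.
    have H2 : idm K' ∘ u' = u' /\ c' ∘ idm K' = c' by rewrite comp_idl comp_idr.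
    have := gU (exist _ (k ∘ h) H1); rewrite (gU (exist _ (idm K') H2)).
    by move/(congr1 sval).
  have [g [_ gU]] := U _ _ _ ec pb.
  rewrite -(gU (h ∘ k)); first by apply: gU; rewrite comp_idl comp_idr.
  by rewrite -comp_assoc ku comp_assoc ch hu'.
clear k ku ck tT t0T; move: h hi hu' ch => /= h hi hu' ch.
destruct hi; rewrite comp_idl in hu'; rewrite comp_idr in ch; subst u' c'.
move=> /=; split=> // num; split; first exact: (tree_map_exists_unique ax num).
have graft (T : C -> tree (ar num)) : tree_map T -> exists a : seq nat,
    [/\ input_path num m a, is_pos (T B) a, subtree (T B) a = T D &
        T X = replace_at (T B) a (T A)].
  by move=> mT; apply: (tree_map_graft ax mT hm ec pb cj).
(* The address that [R] gives to [m] is also an input path of [m], so it equals [a]. *)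
split=> // R [_ mR _ Rm]; have [a [pa _ _ ->]] := graft _ mR.
by rewrite (input_path_fun ax pa (proj2 (Rm _ _ _ hm))).
Qed.
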